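(* For all integers $n,\lambda,r\ge 0$ and $m,x\ge 1$, $$D^{\lambda,x}_{m,r}(n)=\sum_{e_1+e_2+\cdots+e_{\lambda+1}=n}\binom{n}{e_1,e_2,\ldots,e_{\lambda+1}}\,r^{e_1}\,B_{e_2}(0,m,x)\,B_{e_3}(0,m,x)\cdots B_{e_{\lambda+1}}(0,m,x),$$ where the sum is over all $(\lambda+1)$-tuples of non-negative integers $(e_1,\ldots,e_{\lambda+1})$ with sum $n$.
   Context: For integers $n,r,\lambda\ge 0$ and $m,x\ge 1$, $D^{\lambda,x}_{m,r}(n)$ (the higher order non-degenerate $r$-Dowling polynomial) is the number of $(r,m,x,\lambda)$-partitions of $\{1,\ldots,n+r\}$, i.e. set partitions of $\{1,\ldots,n+r\}$ carrying the following extra data. (i) The elements $1,\ldots,r$ lie in $r$ distinct blocks, called distinguished blocks; all other blocks are called non-distinguished. (ii) In each non-distinguished block every element except the largest one is colored independently with one of $m$ colors. (iii) Each non-distinguished block is colored independently with one of $x$ colors. (iv) Each non-distinguished block is assigned independently to one of $\lambda$ sections. (v) Neither the distinguished blocks nor their elements are colored. The generalized Bell polynomials $B_e(0,m,x)$ (non-degenerate case $\alpha=0$, with $r=0$) are $$B_e(0,m,x)=\sum_{k=0}^{e}S(e,k;0,m,0)\,x^k,$$ where the numbers $S(e,k;0,m,0)$ are defined by $\sum_{e\ge 0}S(e,k;0,m,0)\frac{z^e}{e!}=\frac{1}{k!}\left(\frac{e^{mz}-1}{m}\right)^k$ (in this generating function the base $e$ of the exponential is Euler's number). The symbol $\binom{n}{e_1,\ldots,e_{\lambda+1}}=\frac{n!}{e_1!\cdots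 e_{\lambda+1}!}$ is the multinomial coefficient, and $0^0=1$. *)

(* Defs.v *)
From HB Require Import structures.
From mathcomp Require Import all_boot all_order all_algebra.

Set Implicit Arguments.
Unset Strict Implicit.
Unset Printing Implicit Defensive.

Import GRing.Theory Num.Theory.

Section DowlingPartitions.

(* The set {1, ..., n + r} is represented by 'I_(n + r): the ordinal i stands
   for i + 1, so the elements 1, ..., r are the ordinals i with i < r. *)
Variables (r m x lambda n : nat).
Local Notation E := 'I_(n + r).

Definition distinguished (B : {set E}) : bool := [exists i in B, i < r].

Definition is_largest (B : {set E}) (i : E) : bool :=
  (i \in B) && [forall j in B, j <= i].

Definition separates_distinguished (P : {set {set E}}) : bool :=
  [forall B in P, forall i in B, forall j in B,
     (i < r) && (j < r) ==> (i == j)].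

Definition nondistinguished_block (P : {set {set E}}) (B : {set E}) : bool :=
  (B \in P) && ~~ distinguished B.

Definition colored_element (P : {set {set E}}) (i : E) : bool :=
  [exists B : {set E},
     [&& nondistinguished_block P B, i \in B & ~~ is_largest B i]].

(* Partition, colors of elements, colors of blocks, sections of blocks.
   The value None means "carries no color (or section)"; prescribing exactly
   where it occurs makes distinct codes represent distinct partitions. *)
Definition dowling_data : finType :=
  ({set {set E}} * {ffun E -> option 'I_m} *
   {ffun {set E} -> option 'I_x} * {ffun {set E} -> option 'I_lambda})%type.

Definition is_dowling_partition (q : dowling_data) : bool :=
  let: (P, elt_color, blk_color, blk_section) := q in
  [&& partition P [set: E],
      separates_distinguished P,
      [forall i : E, isSome (elt_color i) == colored_element P i],
      [forall B : {set E},
         isSome (blk_color B) == nondistinguished_block P B]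
    & [forall B : {set E},
         isSome (blk_section B) == nondistinguished_block P B]].

Definition dowling : nat := #|[set q : dowling_data | is_dowling_partition q]|.

End DowlingPartitions.

Local Open Scope ring_scope.

(* Formal power series over the rationals, given by their coefficients. *)
Definition fps : Type := nat -> rat.

Definition fps_one : fps := fun i => (i == 0%N)%:R.
Definition fps_sub (a b : fps) : fps := fun i => a i - b i.
Definition fps_scale (c : rat) (a : fps) : fps := fun i => c * a i.
Definition fps_mul (a b : fps) : fps :=
  fun i => \sum_(j < i.+1) a j * b (i - j)%N.
Definition fps_pow (a : fps) (k : nat) : fps := iter k (fps_mul a) fps_one.

(* exp (c z) *)
Definition fps_exp (c : rat) : fps := fun i => c ^+ i / i`!%:R.

(* (1 / k!) ((exp (m z) - 1) / m) ^ k *)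
Definition stirling_egf (m k : nat) : fps :=
  fps_scale (k`!%:R)^-1
    (fps_pow (fps_scale (m%:R)^-1 (fps_sub (fps_exp m%:R) fps_one)) k).

(* S(e, k; 0, m, 0): e! times the coefficient of z ^ e. *)
Definition gen_stirling (m e k : nat) : rat := e`!%:R * stirling_egf m k e.

(* B_e(0, m, x) *)
Definition gen_bell (m x e : nat) : rat :=
  \sum_(k < e.+1) gen_stirling m e k * x%:R ^+ k.

Definition multinomial_coef (n l : nat) (e : {ffun 'I_l -> 'I_n.+1}) : rat :=
  n`!%:R / \prod_(i < l) (e i)`!%:R.

(* Main.v *)
Require Import Defs.
From HB Require Import structures.
From mathcomp Require Import all_boot all_order all_algebra.
From mathcomp Require Import ring.

Set Implicit Arguments.
Unset Strict Implicit.
Unset Printing Implicit Defensive.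

Import GRing.Theory Num.Theory.
Local Open Scope ring_scope.

(** The number of Dowling partitions is a sum over set partitions [P] of a
product over the blocks of [P] of a weight [w B]. A distinguished block counts
1, a block with two or more of the [r] special elements counts 0, and any other
block [B] counts [lambda * x * m ^ (#|B| - 1)]: a section, a block color, and
one color for each element but the largest.

Such weighted sums obey a recursion, obtained by cutting out the block of a
chosen element [a] ([partition_sum_rec]). Let [f t k] be the sum for a set with
[t] special and [k] other elements; [f 0 0 = 1].
- If [a] is special, its block is [a] with any set of non-special elements, so
  [f (t + 1) k = sum_j C(k, j) f t (k - j)]. For the exponential generating
  functions [F_t] this says [F_(t + 1) = exp(z) F_t].
- If [t = 0], then [f 0 (k + 1) = sum_j C(k, j) lambda x m^j f 0 (k - j)],
  that is [F_0' = lambda x exp(m z) F_0], with [F_0(0) = 1].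
These equations determine [f] ([partition_sum_block_weight]).

The right-hand side of the theorem is [n!] times the coefficient of [z ^ n] in
[exp(r z) G(z) ^ lambda], where [G] is the exponential generating function of
the generalized Bell numbers ([multinomial_convolution]). Here
[G = exp(x (exp(m z) - 1) / m)] satisfies [G' = x exp(m z) G] ([gen_bellS]),
hence [G ^ lambda] solves the differential equation of [F_0]
([dowling_egf_ode]), and [exp(t z) G ^ lambda] is [F_t]
([dowling_egf_distinguished]).

Each power series is represented by its truncation to a polynomial of degree at
most [N], so that polynomial multiplication and derivation are available.
Identities between products of series then hold for the coefficients of low
degree, which the truncation does not affect. *)

(** * Weighted sums over set partitions *)

Definition partition_sum (R : comNzSemiRingType) (T : finType)
    (w : {set T} -> R) (A : {set T}) : R :=
  \sum_(P : {set {set T}} | partition P A) \prod_(B in P) w B.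

Lemma partition_sum_set0 (R : comNzSemiRingType) (T : finType)
    (w : {set T} -> R) : partition_sum w set0 = 1.
Proof.
rewrite /partition_sum (big_pred1 set0) ?big_set0 // => P.
by rewrite partition_set0.
Qed.

(** A partition of [A] is the block [a |: C] of [a] together with a partition of
what remains, and [C] can be any subset of [A :\ a]. *)
Lemma partition_sum_rec (R : comNzSemiRingType) (T : finType)
    (w : {set T} -> R) (A : {set T}) (a : T) : a \in A ->
  partition_sum w A =
  \sum_(C : {set T} | C \subset A :\ a)
     w (a |: C) * partition_sum w ((A :\ a) :\: C).
Proof.
move=> aA; rewrite /partition_sum.
rewrite (partition_big (fun P => pblock P a :\ a)
          (fun C : {set T} => C \subset A :\ a)) /=; last first.
  move=> P prP; apply: setSD; apply: (partitionS prP).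
  by apply: pblock_mem; rewrite (cover_partition prP).
apply: eq_bigr => C sCA; rewrite mulr_sumr.
have aC : a \notin C.
  by apply: contraL sCA => aC; apply/subsetPn; exists a; rewrite ?inE ?eqxx.
have sBA : a |: C \subset A.
  by rewrite subUset sub1set aA (subset_trans sCA) ?subD1set.
have -> : (A :\ a) :\: C = A :\: (a |: C) by rewrite setDDl.
have blockP P : partition P A -> pblock P a :\ a = C -> a |: C \in P.
  move=> prP <-.
  have aP : a \in cover P by rewrite (cover_partition prP).
  by rewrite setD1K ?mem_pblock // pblock_mem.
have freshB Q : partition Q (A :\: (a |: C)) -> a |: C \notin Q.
  move=> prQ; apply/negP=> /(partitionS prQ)/subsetP/(_ a).
  by rewrite !inE eqxx => /(_ isT).
rewrite (reindex_onto (fun Q => (a |: C) |: Q) (fun P => P :\ (a |: C))) /=;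
  last first.
  by move=> P /andP[prP /eqP eC]; rewrite setD1K ?blockP.
apply: eq_big => [Q|Q /andP[/andP[prP /eqP eC] /eqP eQ]]; last first.
  by rewrite big_setU1 // -eQ !inE eqxx.
apply/idP/idP => [/andP[/andP[prP /eqP eC] /eqP <-]|prQ].
  by apply: (partitionD1 prP); apply: blockP.
have prP : partition ((a |: C) |: Q) A.
  have <- : (a |: C) :|: (A :\: (a |: C)) = A.
    by rewrite -[RHS](setID A (a |: C)) (setIidPr sBA).
  apply: partitionU1 => //; first by apply/set0Pn; exists a; rewrite setU11.
  by rewrite disjoints_subset setDE setCI setCK subsetUr.
rewrite prP setU1K ?freshB // eqxx andbT.
rewrite (def_pblock (partition_trivIset prP) (B := a |: C)) ?setU11 //.
by rewrite setU1K ?eqxx.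
Qed.

Lemma sum_subsets_by_card (R : nzSemiRingType) (T : finType) (A : {set T})
    (F : nat -> R) :
  \sum_(C : {set T} | C \subset A) F #|C| =
  \sum_(k < #|A|.+1) 'C(#|A|, k)%:R * F k.
Proof.
rewrite (partition_big (fun C : {set T} => inord #|C| : 'I_#|A|.+1) predT) //=.
apply: eq_bigr => k _.
have -> : 'C(#|A|, k) = #|[set C : {set T} | C \subset A & #|C| == k]|.
  by rewrite cards_draws.
rewrite -[#|finset _|]sum1_card natr_sum mulr_suml big_set.
apply: eq_big => [C|C /andP[sCA /eqP <-]].
  rewrite unfold_in; case sCA: (C \subset A) => //=.
  by rewrite -val_eqE /= inordK // ltnS subset_leq_card.
by rewrite mul1r inordK // ltnS subset_leq_card.
Qed.

(** The weight vanishes on the blocks that contain two elements of [D]; this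
encodes the requirement that the elements of [D] lie in distinct blocks. *)
Definition block_weight (R : comNzSemiRingType) (T : finType) (D : {set T})
    (c d : R) (B : {set T}) : R :=
  if B :&: D == set0 then c * d ^+ #|B|.-1 else (#|B :&: D| <= 1)%N%:R.

(** The recursions for [f] are those obtained by removing the block of an
element of [D] if there is one, and of any element otherwise. The bound [N] makes room
for functions [f] read off truncated power series, for which the recursions
hold only in a limited range. *)
Lemma partition_sum_block_weight (R : comNzSemiRingType) (T : finType)
    (D : {set T}) (c d : R) (N : nat) (f : nat -> nat -> R) :
    f 0 0 = 1 ->
    (forall k, (k < N)%N ->
       f 0 k.+1 = \sum_(j < k.+1) 'C(k, j)%:R * (c * d ^+ j * f 0 (k - j)%N)) ->
    (forall t k, (k <= N)%N ->
       f t.+1 k = \sum_(j < k.+1) 'C(k, j)%:R * f t (k - j)%N) ->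
  forall A : {set T}, (#|A :\: D| <= N)%N ->
  partition_sum (block_weight D c d) A = f #|A :&: D| #|A :\: D|.
Proof.
move=> f00 f0S fS A; move: {2}#|A| (leqnn #|A|) => s.
elim: s A => [|s IHs] A leAs leAN.
  move: leAs; rewrite leqn0 cards_eq0 => /eqP->.
  by rewrite set0I set0D cards0 f00 partition_sum_set0.
have [AD0|/set0Pn[a]] := eqVneq (A :&: D) set0; last first.
  rewrite inE => /andP[aA aD].
  have sAD : A :\: D \subset A :\ a by apply: setDS; rewrite sub1set.
  have eAD : #|A :&: D| = #|(A :\ a) :&: D|.+1.
    by rewrite (cardsD1 a) !inE aA aD setIDAC.
  rewrite (partition_sum_rec _ aA) eAD fS //.
  (* Only the blocks a |: C with C disjoint from D have nonzero weight. *)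
  rewrite -(sum_subsets_by_card (A :\: D) (fun j => f _ (#|A :\: D| - j)%N)).
  rewrite (bigID (fun C : {set T} => C \subset A :\: D)) /= addrC big1 ?add0r.
    apply: eq_big => [C|C /andP[sCa sCA]].
      by rewrite andb_idl // => /subset_trans->.
    have CD0 : C :&: D = set0.
      by apply/eqP; rewrite setI_eq0; case/subsetDP: sCA.
    have eaD : (a |: C) :&: D = [set a].
      by rewrite setIUl CD0 setU0; apply/setIidPl; rewrite sub1set.
    rewrite /block_weight eaD cards1 -cards_eq0 cards1 mul1r.
    have eAC : (A :\ a :\: C) :\: D = (A :\: D) :\: C.
      apply/setP=> z; rewrite !inE; case: eqP => [->|_]; rewrite ?aD ?andbF //=.
      by rewrite andbCA.
    have eACD : (A :\ a :\: C) :&: D = (A :\ a) :&: D.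
      apply/setP=> z; rewrite !inE; case zC: (z \in C) => //=.
      have /setP/(_ z) := CD0; rewrite !inE zC /= => ->.
      by rewrite !andbF.
    rewrite IHs ?eAC ?eACD.
    - by rewrite (cardsD (A :\: D)) (setIidPr sCA).
    - rewrite -ltnS (leq_trans _ leAs) // (cardsD1 a A) aA ltnS.
      by rewrite subset_leq_card ?subsetDl.
    - by rewrite (leq_trans _ leAN) // subset_leq_card ?subsetDl.
  move=> C /andP[sCa nsCA]; rewrite /block_weight.
  have /subsetPn[z zC zAD] := nsCA.
  have zD : z \in D.
    move: zAD; rewrite inE negb_and negbK.
    by have /setD1P[_ ->] := subsetP sCa z zC; rewrite orbF.
  have za : z != a by have /setD1P[] := subsetP sCa z zC.
  have leaD : (1 < #|(a |: C) :&: D|)%N.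
    by rewrite (cardsD1 a) (cardsD1 z) !inE eqxx aD za zC zD orbT.
  by rewrite -cards_eq0 leqNgt leaD gtn_eqF ?mul0r // (ltn_trans _ leaD).
rewrite AD0 cards0.
have AD : A :\: D = A by apply/setDidPl; rewrite -setI_eq0 AD0.
have [->|[a aA]] := set_0Vmem A.
  by rewrite set0D cards0 partition_sum_set0.
rewrite (partition_sum_rec _ aA) AD.
have cA : #|A| = #|A :\ a|.+1 by rewrite (cardsD1 a) aA.
rewrite cA f0S; last by rewrite -cA -AD.
rewrite -(sum_subsets_by_card _
            (fun j => c * d ^+ j * f 0 (#|A :\ a| - j)%N)).
apply: eq_bigr => C sCA.
have aC : a \notin C.
  by apply: contraL sCA => aC; apply/subsetPn; exists a; rewrite ?inE ?eqxx.
have sub0 (B : {set T}) : B \subset A -> B :&: D = set0.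
  by move=> sBA; apply/eqP; rewrite -subset0 -AD0 setSI.
have sBA : a |: C \subset A.
  by rewrite subUset sub1set aA (subset_trans sCA) ?subD1set.
have sA' : A :\ a :\: C \subset A.
  by rewrite (subset_trans (subsetDl _ _)) ?subD1set.
have D0 : (A :\ a :\: C) :\: D = A :\ a :\: C.
  by apply/setDidPl; rewrite -setI_eq0 sub0.
rewrite /block_weight sub0 // eqxx cardsU1 aC /= IHs.
- by rewrite sub0 // D0 cards0 (cardsD (A :\ a)) (setIidPr sCA).
- by rewrite -ltnS (leq_trans _ leAs) // cA ltnS subset_leq_card ?subsetDl.
- by rewrite (leq_trans _ leAN) // AD D0 subset_leq_card.
Qed.

(** * Counting the decorations of a set partition *)

Definition distinguished_elements (r n : nat) : {set 'I_(n + r)} :=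
  [set i : 'I_(n + r) | (i < r)%N].

Lemma card_distinguished_elements (r n : nat) :
  #|distinguished_elements r n| = r.
Proof.
have widen_inj : injective (widen_ord (leq_addl n r)).
  by move=> i j /(congr1 val) /= /val_inj.
rewrite -[RHS]card_ord -cardsT -(card_imset _ widen_inj).
apply: eq_card => i; rewrite !inE; apply/idP/imsetP => [ltir|[j _ ->]] //=.
by exists (Ordinal ltir) => //; apply: val_inj.
Qed.

Lemma card_ffun_support (aT : finType) (k : nat) (D : pred aT) :
  #|[set f : {ffun aT -> option 'I_k} | [forall a, isSome (f a) == D a]]|
  = (k ^ #|D|)%N.
Proof.
have cSome : #|[pred u : option 'I_k | isSome u]| = k.
  rewrite -[RHS]card_ord -(card_image (@Some_inj _ : injective (@Some 'I_k))).
  apply: eq_card => -[i|]; rewrite !inE ?image_f //.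
  by apply/esym/imageP => -[].
rewrite -[in RHS]cSome -(card_pffun_on None); apply: eq_card => f; rewrite inE.
apply/forallP/pffun_onP => [fD | [/subsetP sD sf] a].
  split=> [|u /imageP[a aD ->]]; last by rewrite inE (eqP (fD a)).
  apply/subsetP=> a; rewrite -[a \in D]/(D a) -(eqP (fD a)) inE /=.
  by case: (f a).
apply/eqP; apply/idP/idP => [fa|aD].
  by apply: sD; rewrite inE /=; case: (f a) fa.
by have := sf (f a); rewrite image_f // inE => ->.
Qed.

Lemma card_nonlargest (r n : nat) (B : {set 'I_(n + r)}) : B != set0 ->
  #|[set i in B | ~~ is_largest B i]| = #|B|.-1.
Proof.
case/set0Pn=> b bB.
case: (arg_maxnP (fun i : 'I_(n + r) => val i) bB) => u /= uB umax.
rewrite (cardsD1 u B) (uB : u \in B) /=; apply: eq_card => i; rewrite !inE.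
case iB: (i \in B); rewrite ?andbF //= andbT /is_largest iB /=.
congr (~~ _); apply/forallP/eqP => [ile|-> j].
  apply/val_inj/eqP; rewrite eqn_leq umax //=.
  by have /implyP/(_ uB) := ile u.
by apply/implyP; apply: umax.
Qed.

Lemma colored_elementE (r n : nat) (P : {set {set 'I_(n + r)}})
    (B : {set 'I_(n + r)}) (i : 'I_(n + r)) :
  partition P [set: 'I_(n + r)] -> B \in P -> i \in B ->
  colored_element P i = ~~ distinguished B && ~~ is_largest B i.
Proof.
move=> prP BP iB.
apply/existsP/andP => [[C /and3P[/andP[CP dC] iC lC]]|[dB lB]].
  have tiP := partition_trivIset prP.
  by rewrite -(def_pblock tiP BP iB) (def_pblock tiP CP iC).
by exists B; rewrite /nondistinguished_block BP dB iB.
Qed.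

Lemma card_colored_elements (r n : nat) (P : {set {set 'I_(n + r)}}) :
  partition P [set: 'I_(n + r)] ->
  #|[set i | colored_element P i]|
  = (\sum_(B in P | ~~ distinguished B) #|B|.-1)%N.
Proof.
move=> prP; rewrite -sum1_card.
rewrite (eq_bigl (fun i => (i \in [set: 'I_(n + r)]) && colored_element P i));
  last by move=> i; rewrite !inE.
rewrite (set_partition_big_cond _ prP) [RHS]big_mkcondr.
apply: eq_bigr => B BP.
rewrite (eq_bigl (fun i =>
  (i \in B) && (~~ distinguished B && ~~ is_largest B i))); last first.
  by move=> i; case iB: (i \in B) => //=; rewrite (colored_elementE prP BP).
case: ifP => _ /=; last by rewrite big1 // => i; rewrite andbF.
by rewrite -(card_nonlargest (partition_neq0 prP BP)) -sum1dep_card.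
Qed.

Lemma separates_distinguishedE (r n : nat) (P : {set {set 'I_(n + r)}}) :
  separates_distinguished P =
  [forall B in P, #|B :&: distinguished_elements r n| <= 1]%N.
Proof.
apply: eq_forallb_in => B BP; apply/forallP/card_le1_eqP => [sB i j|sB i].
  rewrite !inE => /andP[iB ir] /andP[jB jr].
  have /implyP/(_ iB)/forallP/(_ j)/implyP/(_ jB) := sB i.
  by rewrite ir jr => /eqP.
apply/implyP => iB; apply/forallP => j; apply/implyP => jB.
apply/implyP => /andP[ir jr]; apply/eqP.
by apply: sB; rewrite !inE ?iB ?jB.
Qed.

Lemma distinguishedE (r n : nat) (B : {set 'I_(n + r)}) :
  distinguished B = (B :&: distinguished_elements r n != set0).
Proof.
apply/existsP/set0Pn => -[i]; first by move=> iB; exists i; rewrite !inE.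
by rewrite !inE; exists i.
Qed.

Lemma sum_over_fibers (S T : finType) (q : pred (S * T)) (g : pred S)
    (h : S -> pred T) (F : S -> nat) :
  (forall s t, q (s, t) = g s && h s t) ->
  (\sum_(p | q p) F p.1 = \sum_(s | g s) F s * #|[set t | h s t]|)%N.
Proof.
move=> qE; rewrite (eq_bigl (fun p => g p.1 && h p.1 p.2)); last by case.
rewrite -(pair_big_dep g h (fun s _ => F s)) /=.
by apply: eq_bigr => s _; rewrite sum_nat_const mulnC cardsE.
Qed.

(** Which elements and blocks carry a color or a section depends on the
underlying set partition only, so the three decorations are chosen
independently and can be summed out one after the other. *)
Lemma dowling_count (r m x lambda n : nat) :
  dowling r m x lambda n =
  (\sum_(P : {set {set 'I_(n + r)}} |
      partition P [set: 'I_(n + r)] && separates_distinguished P)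
    m ^ #|[set i | colored_element P i]| *
    x ^ #|[set B | nondistinguished_block P B]| *
    lambda ^ #|[set B | nondistinguished_block P B]|)%N.
Proof.
pose okP (P : {set {set 'I_(n + r)}}) :=
  partition P [set: 'I_(n + r)] && separates_distinguished P.
pose okE (P : {set {set 'I_(n + r)}}) k
    (ec : {ffun 'I_(n + r) -> option 'I_k}) :=
  [forall i, isSome (ec i) == colored_element P i].
pose okB (P : {set {set 'I_(n + r)}}) k
    (bc : {ffun {set 'I_(n + r)} -> option 'I_k}) :=
  [forall B, isSome (bc B) == nondistinguished_block P B].
rewrite /dowling -sum1dep_card.
rewrite (sum_over_fibers (fun=> 1)%N
  (g := fun p => [&& okP p.1.1, okE p.1.1 m p.1.2 & okB p.1.1 x p.2])
  (h := fun p => okB p.1.1 lambda)); last first.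
  by move=> [[P ec] bc] bs; rewrite /= /okP !andbA.
under eq_bigr => p _ do rewrite card_ffun_support mul1n.
rewrite (sum_over_fibers (fun p => lambda ^ #|nondistinguished_block p.1|)%N
  (g := fun p => okP p.1 && okE p.1 m p.2)
  (h := fun p => okB p.1 x)); last first.
  by move=> [P ec] bc; rewrite /= !andbA.
under eq_bigr => p _ do rewrite card_ffun_support.
rewrite (sum_over_fibers (fun P => lambda ^ #|nondistinguished_block P| *
                                   x ^ #|nondistinguished_block P|)%N
  (g := okP) (h := fun P => okE P m)) //.
apply: eq_bigr => P _; rewrite card_ffun_support !cardsE.
by rewrite mulnC mulnA mulnAC.
Qed.

Lemma dowling_partition_sum (r m x lambda n : nat) (R : comNzSemiRingType) :
  (dowling r m x lambda n)%:R =
  partition_sum (block_weight (distinguished_elements r n)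
                   ((lambda * x)%:R : R) m%:R) [set: 'I_(n + r)].
Proof.
rewrite dowling_count natr_sum /partition_sum [LHS]big_mkcondr.
apply: eq_bigr => P prP; rewrite separates_distinguishedE.
case: ifP => [/forall_inP sP | /negbT/forall_inPn[B BP nB]]; last first.
  (* A block with two special elements makes the whole product vanish. *)
  rewrite (bigD1 B) //= /block_weight -cards_eq0.
  by case: #|_| nB => [|[|k]] //= _; rewrite mul0r.
rewrite card_colored_elements //; set e := (\sum_(B in P | _) _)%N.
rewrite (eq_bigr (fun B =>
  if distinguished B then 1
  else (lambda * x)%:R * m%:R ^+ #|B|.-1)); last first.
  move=> B BP; rewrite /block_weight distinguishedE sP //.
  by case: eqP.
rewrite (bigID (@distinguished r n)) /= [X in _ = X * _]big1 ?mul1r; last first.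
  by move=> B /andP[_ ->].
rewrite (eq_bigr (fun B : {set 'I_(n + r)} =>
  (lambda * x)%:R * m%:R ^+ #|B|.-1 : R)); last first.
  by move=> B /andP[_ /negbTE->].
rewrite big_split /= prodr_const -expr_sum.
have -> : #|[pred B in P | ~~ distinguished B]| =
          #|[set B | nondistinguished_block P B]|.
  by rewrite cardsE; apply: eq_card => B; rewrite !inE.
by rewrite -mulnA -expnMn [(x * _)%N]mulnC natrM !natrX mulrC.
Qed.

(** * Truncated exponential generating functions *)

Definition egf (N : nat) (a : nat -> rat) : {poly rat} :=
  \poly_(i < N.+1) (a i / i`!%:R).

Lemma fact_neq0 (k : nat) : k`!%:R != 0 :> rat.
Proof. by rewrite pnatr_eq0 -lt0n fact_gt0. Qed.

Lemma coef_egf (N : nat) (a : nat -> rat) (i : nat) :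
  (i <= N)%N -> (egf N a)`_i = a i / i`!%:R.
Proof. by move=> leiN; rewrite coef_poly ltnS leiN. Qed.

Lemma eq_coefMl (R : nzSemiRingType) (p p' q : {poly R}) (k : nat) :
  (forall i, (i <= k)%N -> p`_i = p'`_i) -> (p * q)`_k = (p' * q)`_k.
Proof.
by move=> eqp; rewrite !coefM; apply: eq_bigr => i _; rewrite eqp // -ltnS.
Qed.

(** Multiplying exponential generating functions is binomial convolution; only
the first factor is written as [egf N a] because the second one is often a power
or a product. *)
Lemma coef_egfM (N : nat) (a : nat -> rat) (q : {poly rat}) (k : nat) :
  (k <= N)%N ->
  k`!%:R * (egf N a * q)`_k
  = \sum_(j < k.+1) 'C(k, j)%:R * (a j * ((k - j)`!%:R * q`_(k - j))).
Proof.
move=> lekN; rewrite coefM mulr_sumr; apply: eq_bigr => j _.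
have lejk : (j <= k)%N by rewrite -ltnS.
rewrite coef_egf ?(leq_trans lejk) // -(bin_fact lejk) !natrM.
by field; rewrite fact_neq0.
Qed.

Lemma coef_egf_expM (N : nat) (b c : rat) (k : nat) : (k <= N)%N ->
  (egf N (GRing.exp b) * egf N (GRing.exp c))`_k
  = (egf N (GRing.exp (b + c)))`_k.
Proof.
move=> lekN; apply: (mulfI (fact_neq0 k)); rewrite coef_egfM // coef_egf //.
rewrite mulrC divfK ?fact_neq0 // addrC exprDn; apply: eq_bigr => j _.
have lekj : (k - j <= N)%N by rewrite (leq_trans _ lekN) ?leq_subr.
rewrite coef_egf // [_`!%:R * _]mulrC divfK ?fact_neq0 //.
by rewrite mulr_natl [b ^+ _ * _]mulrC.
Qed.

(** * The generalized Stirling and Bell numbers *)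

Definition stirling_base (m : nat) : fps :=
  fps_scale (m%:R)^-1 (fps_sub (fps_exp m%:R) fps_one).

Lemma fps_pow_coef (a : fps) (N k i : nat) : (i <= N)%N ->
  fps_pow a k i = ((\poly_(j < N.+1) a j) ^+ k)`_i.
Proof.
elim: k i => [|k IHk] i leiN; first by rewrite expr0 coef1.
rewrite /fps_pow iterS -/(fps_pow a k) exprS coefM; apply: eq_bigr => j _.
have leji : (j <= i)%N by rewrite -ltnS.
by rewrite coef_poly ltnS (leq_trans leji) // IHk // (leq_trans (leq_subr _ _)).
Qed.

Lemma gen_stirlingE (m e k N : nat) : (e <= N)%N ->
  gen_stirling m e k =
  e`!%:R * ((\poly_(j < N.+1) stirling_base m j) ^+ k)`_e / k`!%:R.
Proof.
move=> leeN; rewrite /gen_stirling /stirling_egf /fps_scale.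
by rewrite (fps_pow_coef _ _ leeN) -mulrA [_^-1 * _]mulrC.
Qed.

Lemma gen_stirlingS0 (m e : nat) : gen_stirling m e.+1 0 = 0.
Proof. by rewrite (gen_stirlingE _ _ (leqnn _)) expr0 coef1 mulr0 mul0r. Qed.

(** With [g = (exp(m z) - 1) / m], the derivative of [g ^ (k + 1) / (k + 1)!] is
[g' g ^ k / k!], and [g' = exp(m z)]. *)
Lemma gen_stirlingSS (m e k : nat) : (0 < m)%N ->
  gen_stirling m e.+1 k.+1 =
  \sum_(j < e.+1) 'C(e, j)%:R * (m%:R ^+ j * gen_stirling m (e - j) k).
Proof.
move=> m_gt0; rewrite (gen_stirlingE _ _ (leqnn _)).
set g := \poly_(_ < _) _.
have dg i : (i <= e)%N -> g^`()`_i = (egf e (GRing.exp m%:R))`_i.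
  move=> leie; rewrite coef_deriv coef_poly coef_egf // !ltnS leie.
  rewrite /stirling_base /fps_scale /fps_sub /fps_exp /fps_one /= subr0.
  rewrite -mulr_natr factS natrM exprS.
  have m_neq0 : m%:R != 0 :> rat by rewrite pnatr_eq0 -lt0n.
  by field; rewrite fact_neq0 m_neq0 nat1r pnatr_eq0.
have -> : e.+1`!%:R * (g ^+ k.+1)`_e.+1 / k.+1`!%:R
       = e`!%:R * (egf e (GRing.exp m%:R) * g ^+ k)`_e / k`!%:R.
  have -> : (g ^+ k.+1)`_e.+1 = (g^`() * g ^+ k)`_e * k.+1%:R / e.+1%:R.
    apply: (canRL (mulfK _)); first by rewrite pnatr_eq0.
    by rewrite !mulr_natr -coef_deriv deriv_exp coefMn.
  rewrite -(eq_coefMl _ dg) !factS !natrM.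
  by field; rewrite fact_neq0 !nat1r !pnatr_eq0.
rewrite coef_egfM // mulr_suml; apply: eq_bigr => j _.
by rewrite (gen_stirlingE _ _ (leq_trans (leq_subr j e) (leqnSn e))) -!mulrA.
Qed.

Lemma gen_stirling_small (m e k : nat) : (0 < m)%N -> (e < k)%N ->
  gen_stirling m e k = 0.
Proof.
move=> m_gt0; elim: k e => // k IHk [|e] ltek.
  rewrite (gen_stirlingE _ _ (leqnn _)) exprS coefM big_ord1 /= coef_poly /=.
  rewrite /stirling_base /fps_scale /fps_sub /fps_exp /fps_one /= expr0.
  rewrite fact0 mulr1n divr1.
  by rewrite subrr mulr0 mul0r mulr0 mul0r.
rewrite gen_stirlingSS // big1 // => j _; rewrite IHk ?mulr0 //.
by rewrite (leq_ltn_trans (leq_subr _ _)).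
Qed.

Lemma gen_bell0 (m x : nat) : gen_bell m x 0 = 1.
Proof.
rewrite /gen_bell big_ord1 (gen_stirlingE _ _ (leqnn _)) !expr0 coef1 /=.
by rewrite !mulr1 fact0.
Qed.

(** The differential equation [G' = x exp(m z) G] for the exponential generating
function [G] of [gen_bell m x], coefficient by coefficient. *)
Lemma gen_bellS (m x e : nat) : (0 < m)%N ->
  gen_bell m x e.+1 =
  x%:R * \sum_(j < e.+1) 'C(e, j)%:R * (m%:R ^+ j * gen_bell m x (e - j)).
Proof.
move=> m_gt0; rewrite /gen_bell big_ord_recl gen_stirlingS0 mul0r add0r.
under eq_bigr => k _ do rewrite gen_stirlingSS // mulr_suml.
rewrite exchange_big mulr_sumr; apply: eq_bigr => j _ /=.
have lej : ((e - j).+1 <= e.+1)%N by rewrite ltnS leq_subr.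
(* The sum defining gen_bell (e - j) can be extended to e + 1 terms, as the
   added ones vanish. *)
rewrite (big_ord_widen _ (fun k => gen_stirling m (e - j) k * x%:R ^+ k) lej).
rewrite [in RHS]big_mkcond !mulr_sumr; apply: eq_bigr => k _.
have [ltk|lek] := ltnP; last by rewrite gen_stirling_small ?mulr0 ?mul0r ?mulr0.
by rewrite exprS; ring.
Qed.

(** * The generating function of the Dowling polynomials *)

(** For [r] special elements, take [t = r]; the other values of [t] occur when
the special elements are removed one by one. *)
Definition dowling_egf (m x lambda N t : nat) : {poly rat} :=
  egf N (GRing.exp t%:R) * egf N (gen_bell m x) ^+ lambda.

Lemma egf_exp0 (N : nat) : egf N (GRing.exp 0) = 1.
Proof.
apply/polyP=> i; rewrite coef1 coef_poly expr0n.
by case: i => [|i] /=; rewrite ?fact0 ?mulr1n ?divr1 // mul0r if_same.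
Qed.

Lemma dowling_egf_const (m x lambda N : nat) :
  (dowling_egf m x lambda N 0)`_0 = 1.
Proof.
rewrite /dowling_egf egf_exp0 mul1r -horner_coef0 horner_exp horner_coef0.
by rewrite coef_egf // gen_bell0 fact0 mulr1n divr1 expr1n.
Qed.

(** The differential equation [V' = lambda x exp(m z) V] for [V = G ^ lambda]
follows from [V' = lambda G' G ^ (lambda - 1)] and [G' = x exp(m z) G], where
[G] is the exponential generating function of [gen_bell m x]. *)
Lemma dowling_egf_ode (m x lambda N k : nat) : (0 < m)%N -> (k < N)%N ->
  (dowling_egf m x lambda N 0)^`()`_k =
  (lambda * x)%:R *
    (egf N (GRing.exp m%:R) * dowling_egf m x lambda N 0)`_k.
Proof.
move=> m_gt0 ltkN; rewrite /dowling_egf egf_exp0 mul1r deriv_exp.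
set p := egf N (gen_bell m x).
have dp i : (i <= k)%N ->
    p^`()`_i = (x%:R *: (egf N (GRing.exp m%:R) * p))`_i.
  move=> leik; have ltiN := leq_ltn_trans leik ltkN.
  have -> : (x%:R *: (egf N (GRing.exp m%:R) * p))`_i
            = gen_bell m x i.+1 / i`!%:R.
    apply: (canRL (mulfK (fact_neq0 i))).
    rewrite coefZ -mulrA [_ * i`!%:R]mulrC.
    rewrite coef_egfM ?(ltnW ltiN) // gen_bellS //; congr (_ * _).
    apply: eq_bigr => j _; congr (_ * (_ * _)).
    have leijN : (i - j <= N)%N.
      by rewrite (leq_trans (leq_subr _ _)) ?(ltnW ltiN).
    by rewrite coef_egf // mulrC divfK ?fact_neq0.
  rewrite coef_deriv coef_egf // -mulr_natr factS natrM.
  by field; rewrite fact_neq0 nat1r pnatr_eq0.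
rewrite coefMn (eq_coefMl _ dp) -scalerAl coefZ -mulrA -exprS.
case: lambda => [|l]; first by rewrite mulr0n mul0n mul0r.
by rewrite /= natrM -mulrA [RHS]mulr_natl.
Qed.

Lemma dowling_egf_distinguished (m x lambda N t k : nat) : (k <= N)%N ->
  (dowling_egf m x lambda N t.+1)`_k =
  (egf N (GRing.exp 1) * dowling_egf m x lambda N t)`_k.
Proof.
move=> lekN; rewrite /dowling_egf mulrA; apply: eq_coefMl => i leik.
by rewrite coef_egf_expM ?(leq_trans leik) // -natr1 addrC.
Qed.

(** Expanding the product by distributivity gives one monomial for each choice
[e] of exponents, and its degree is the sum of the exponents. *)
Lemma multinomial_convolution (n l : nat) (a : 'I_l -> nat -> rat) :
  \sum_(e : {ffun 'I_l -> 'I_n.+1} | (\sum_i e i == n)%N)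
     multinomial_coef e * \prod_i a i (e i)
  = n`!%:R * (\prod_i egf n (a i))`_n.
Proof.
rewrite /egf; under [in RHS]eq_bigr => i _ do rewrite poly_def.
rewrite bigA_distr_bigA coef_sum mulr_sumr big_mkcond; apply: eq_bigr => e _ /=.
rewrite scaler_prod -expr_sum coefZ coefXn eq_sym.
case: eqP => _; last by rewrite !mulr0.
by rewrite mulr1 prodf_div /multinomial_coef -mulrA [_^-1 * _]mulrC.
Qed.

Theorem theorem3p4 (n lambda r m x : nat) (hm : (0 < m)%N) (hx : (0 < x)%N) :
  (dowling r m x lambda n)%:R =
  \sum_(e : {ffun 'I_lambda.+1 -> 'I_n.+1} | (\sum_i e i == n)%N)
     multinomial_coef e * r%:R ^+ e ord0 *
     \prod_(j < lambda) gen_bell m x (e (lift ord0 j)) :> rat.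
Proof.
pose f t k : rat := k`!%:R * (dowling_egf m x lambda n t)`_k.
have cDC : #|[set: 'I_(n + r)] :\: distinguished_elements r n| = n.
  by rewrite setTD cardsCs setCK card_distinguished_elements card_ord addnK.
rewrite dowling_partition_sum.
rewrite (partition_sum_block_weight (N := n) (f := f)) ?cDC //.
- rewrite setTI card_distinguished_elements.
  pose a (i : 'I_lambda.+1) : nat -> rat :=
    if i == ord0 then GRing.exp r%:R else gen_bell m x.
  transitivity (n`!%:R * (\prod_i egf n (a i))`_n).
    rewrite big_ord_recl (eq_bigr (fun=> egf n (gen_bell m x))) //.
    by rewrite prodr_const card_ord.
  rewrite -multinomial_convolution; apply: eq_bigr => e _.
  by rewrite big_ord_recl /= mulrA.
- by rewrite /f dowling_egf_const mulr1.
- move=> k ltkn; rewrite /f.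
  rewrite factS mulnC natrM -mulrA [k.+1%:R * _]mulr_natl -coef_deriv.
  rewrite dowling_egf_ode //.
  rewrite mulrCA coef_egfM ?(ltnW ltkn) // mulr_sumr; apply: eq_bigr => j _.
  by rewrite mulrCA !mulrA.
move=> t k lekn; rewrite /f dowling_egf_distinguished // coef_egfM //.
by apply: eq_bigr => j _; rewrite expr1n mul1r.
Qed.
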